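(* Let $\gamma\in(0,4)$, let $K\ge 1$ be an integer, and let $L>0$. Then there exist an $L$-smooth convex function $\tilde q:\mathbb{R}^2\to\mathbb{R}$ with a minimizer $x^\star$ and minimal value $\tilde q^\star$, and an initial point $x^0\neq x^\star$, such that the iterates generated by $\gamma$-PolyakGD applied to $\tilde q$ from $x^0$ satisfy $$\min_{1\le k\le K}\ \frac{\tilde q(x^k)-\tilde q^\star}{L\|x^0-x^\star\|^2}\ \ge\ \frac{\gamma}{2\,\mathrm{e}^{2\gamma}\big((4-\gamma)K+\gamma\big)},$$ where $\mathrm{e}$ denotes Euler's number.
   Context: For a differentiable convex function $f$ with minimal value $f^\star$ and a parameter $\gamma>0$, $\gamma$-PolyakGD is the iteration $x^{k+1}=x^k-\gamma\,\alpha_k\nabla f(x^k)$ with Polyak stepsize $\alpha_k=\dfrac{f(x^k)-f^\star}{\|\nabla f(x^k)\|^2}$, $k=0,1,\dots$ ($\|\cdot\|$ is the Euclidean norm; if $\nabla f(x^k)=0$ the iteration stays at $x^k$). A differentiable function is $L$-smooth if its gradient is $L$-Lipschitz with respect to the Euclidean norm. *)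

(* Defs.v *)
From mathcomp Require Export all_boot all_order all_algebra.
From mathcomp Require Export all_classical all_reals all_analysis.

Set Implicit Arguments.
Unset Strict Implicit.
Unset Printing Implicit Defensive.

Import Order.TTheory GRing.Theory Num.Theory.
Import numFieldNormedType.Exports.

Local Open Scope classical_set_scope.
Local Open Scope ring_scope.

(* The library's norm on ['rV[R]_n] is the sup norm, hence a separate
   Euclidean norm. Differentiability does not depend on this choice. *)
Definition enorm (R : realType) (n : nat) (x : 'rV[R]_n) : R :=
  Num.sqrt (\sum_(i < n) x ord0 i ^+ 2).

(* The row of partial derivatives; meaningful only where f is differentiable. *)
Definition gradient (R : realType) (n : nat) (f : 'rV[R]_n.+1 -> R)
    (x : 'rV[R]_n.+1) : 'rV[R]_n.+1 :=
  \row_(i < n.+1) 'D_(delta_mx ord0 i) f x.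

Definition smooth (R : realType) (n : nat) (L : R) (f : 'rV[R]_n.+1 -> R) :=
  (forall x, differentiable f x) /\
  (forall x y, enorm (gradient f x - gradient f y) <= L * enorm (x - y)).

Definition minimizer (R : realType) (T : Type) (f : T -> R) (xs : T) :=
  forall x, f xs <= f x.

Definition polyak_stepsize (R : realType) (n : nat) (f : 'rV[R]_n.+1 -> R)
    (fstar : R) (x : 'rV[R]_n.+1) : R :=
  (f x - fstar) / enorm (gradient f x) ^+ 2.

Definition polyakGD_step (R : realType) (n : nat) (gamma : R)
    (f : 'rV[R]_n.+1 -> R) (fstar : R) (x : 'rV[R]_n.+1) : 'rV[R]_n.+1 :=
  if gradient f x == 0 then x
  else x - (gamma * polyak_stepsize f fstar x) *: gradient f x.

Definition polyakGD (R : realType) (n : nat) (gamma : R)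
    (f : 'rV[R]_n.+1 -> R) (fstar : R) (x0 : 'rV[R]_n.+1) (k : nat) :
    'rV[R]_n.+1 :=
  iter k (polyakGD_step gamma f fstar) x0.

(* [min_(1 <= k <= K) F k]; the default [F 1] makes this the genuine minimum
   for every [K >= 1]. *)
Definition min_upto (R : realType) (K : nat) (F : nat -> R) : R :=
  \big[Num.min/F 1%N]_(1 <= k < K.+1) F k.

(* Main.v *)
(* On a diagonal quadratic with weights [a > b > 0] in the plane, the effective
   step [gamma * alpha] depends only on the ratio of the squared coordinates.
   Choose that ratio so that the effective step is [2 / (a + b)]: the two
   coordinates are then multiplied by [- rho] and [rho] with
   [rho = (a - b) / (a + b)], the ratio is preserved, and every iteration
   multiplies the objective gap by exactly [rho ^+ 2]. With [a = L],
   [b = L t / (1 - t)] one gets [rho = 1 - 2 t], and the initial normalised gap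
   is [2 t / (4 - gamma)]. Taking [t] of order [1 / K] keeps
   [rho ^+ (2 * K)] above [expR (- 2 gamma)]. *)

Require Import Defs.
From mathcomp Require Import ring lra.

Set Implicit Arguments.
Unset Strict Implicit.
Unset Printing Implicit Defensive.

Import Order.TTheory GRing.Theory Num.Theory.
Import numFieldNormedType.Exports.
Local Open Scope classical_set_scope.
Local Open Scope ring_scope.

Lemma enorm_sqr (R : realType) (n : nat) (x : 'rV[R]_n) :
  enorm x ^+ 2 = \sum_(i < n) x ord0 i ^+ 2.
Proof. by rewrite sqr_sqrtr// sumr_ge0// => i _; rewrite sqr_ge0. Qed.

Lemma is_derive_coord (R : realType) (n : nat) (x v : 'rV[R]_n) (i : 'I_n) :
  is_derive x v (fun y : 'rV[R]_n => y ord0 i : R) (v ord0 i).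
Proof.
have dx : differentiable (fun y : 'rV[R]_n => y ord0 i : R) x.
  exact: differentiable_coord.
apply: DeriveDef; first exact: diff_derivable.
rewrite deriveE//.
(* Packaged as a linear map, the coordinate is its own differential. *)
have @f : {linear 'rV[R]_n -> R}.
  by exists (fun y : 'rV[R]_n => y ord0 i); do 2![eexists]; do ?[constructor];
     rewrite ?mxE// => ? *; rewrite ?mxE//; move=> ?; rewrite !mxE.
have -> : (fun y : 'rV[R]_n => y ord0 i : R) = f by [].
by rewrite diff_lin//; exact: coord_continuous.
Qed.

Definition diag_quad (R : realType) (n : nat) (w : 'I_n -> R)
    (x : 'rV[R]_n) : R :=
  2^-1 * \sum_(i < n) w i * x ord0 i ^+ 2.

Section DiagonalQuadratic.
Variables (R : realType) (n : nat) (w : 'I_n.+1 -> R).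
Implicit Types x y v : 'rV[R]_n.+1.

(** Point-free form, on which the differentiation rules for sums, scalings and powers act. *)
Let diag_quadE : diag_quad w =
  2^-1 *: \sum_(i < n.+1) w i *: (fun x : 'rV[R]_n.+1 => x ord0 i : R) ^+ 2.
Proof.
apply/funext => x; rewrite /diag_quad/= fctE; congr (_ * _).
by rewrite fct_sumE; apply: eq_bigr => i _; rewrite !fctE.
Qed.

Lemma differentiable_diag_quad x : differentiable (diag_quad w) x.
Proof.
rewrite diag_quadE; apply: differentiableZ; apply: differentiable_sum => i.
by apply: differentiableZ; apply: differentiableX; exact: differentiable_coord.
Qed.

Lemma derive_diag_quad x v :
  'D_v (diag_quad w) x = \sum_(i < n.+1) w i * x ord0 i * v ord0 i.
Proof.
rewrite diag_quadE.
have dc i : is_derive x v (w i *: (fun y : 'rV[R]_n.+1 => y ord0 i : R) ^+ 2)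
   (w i *: ((2%:R * x ord0 i ^+ 1) *: v ord0 i)).
  by apply: is_deriveZ; apply: is_deriveX; exact: is_derive_coord.
rewrite (@derive_val _ _ _ _ _ _ _ (is_deriveZ _ (is_derive_sum dc))).
rewrite scaler_sumr; apply: eq_bigr => i _.
by rewrite /GRing.scale/= expr1; field.
Qed.

Lemma gradient_diag_quad x :
  gradient (diag_quad w) x = \row_i (w i * x ord0 i).
Proof.
apply/rowP => i; rewrite !mxE derive_diag_quad (bigD1 i)//= big1 => [|j ji].
  by rewrite mxE !eqxx mulr1 addr0.
by rewrite mxE (negbTE ji) andbF mulr0.
Qed.

Lemma smooth_diag_quad L : (forall i, 0 <= w i <= L) -> smooth L (diag_quad w).
Proof.
move=> wL; have L0 : 0 <= L by have /andP[/le_trans] := wL ord0; apply.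
split=> [|x y]; first exact: differentiable_diag_quad.
(* Once squared, the Lipschitz bound holds term by term, since [w i ^+ 2 <= L ^+ 2]. *)
rewrite -(ler_pXn2r (ltn0Sn 1)) ?nnegrE ?mulr_ge0 ?sqrtr_ge0//.
rewrite exprMn !enorm_sqr mulr_sumr; apply: ler_sum => i _.
rewrite !gradient_diag_quad !mxE -mulrBr exprMn ler_wpM2r ?sqr_ge0//.
by have /andP[? ?] := wL i; rewrite ler_pXn2r.
Qed.

Lemma convex_diag_quad : (forall i, 0 <= w i) ->
  convex_function [set: convex_lmodType 'rV[R]_n.+1] (diag_quad w).
Proof.
move=> w0 t x y _ _; rewrite convRE /diag_quad.
rewrite mulrCA (mulrCA _ 2^-1) -mulrDr ler_pM2l ?invr_gt0//.
rewrite !mulr_sumr -big_split/=; apply: ler_sum => i _.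
rewrite /conv/= !mxE /unstable.onem.
have t0 : 0 <= t%:num by [].
have t1 : t%:num <= 1 by [].
move: (t%:num) t0 t1 (x ord0 i) (y ord0 i) => s s0 s1 a b.
rewrite -subr_ge0 [X in 0 <= X](_ : _ =
  w i * (s * (1 - s) * (a - b) ^+ 2)); last by ring.
by rewrite mulr_ge0// mulr_ge0 ?sqr_ge0// mulr_ge0// subr_ge0.
Qed.

Lemma diag_quad0 : diag_quad w 0 = 0.
Proof.
by rewrite /diag_quad big1 ?mulr0// => i _; rewrite mxE expr0n mulr0.
Qed.

Lemma minimizer_diag_quad : (forall i, 0 <= w i) -> minimizer (diag_quad w) 0.
Proof.
move=> w0 x; rewrite diag_quad0 mulr_ge0 ?invr_ge0// sumr_ge0// => i _.
by rewrite mulr_ge0// sqr_ge0.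
Qed.

End DiagonalQuadratic.

Definition row2 (R : realType) (a b : R) : 'rV[R]_2 :=
  \row_i (if i == ord0 then a else b).

Section PlanarCycle.
Variables (R : realType) (gamma a b : R).
Hypotheses (b_gt0 : 0 < b) (ba : b < a).

Let w (i : 'I_2) : R := if i == ord0 then a else b.
Let rho := (a - b) / (a + b).

Lemma diag_quad_row2 (u v : R) :
  diag_quad w (row2 u v) = (a * u ^+ 2 + b * v ^+ 2) / 2.
Proof. by rewrite /diag_quad !big_ord_recl big_ord0 !mxE/= addr0 mulrC. Qed.

(** The equation is [gamma * alpha = 2 / (a + b)] with denominators cleared; the multipliers are
    then [1 - 2 * a / (a + b) = - rho] and [1 - 2 * b / (a + b) = rho]. The condition [v != 0] keeps
    the gradient nonzero. *)
Lemma polyakGD_step_row2 (u v : R) : v != 0 ->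
  gamma * (a * u ^+ 2 + b * v ^+ 2) * (a + b)
    = 4 * (a ^+ 2 * u ^+ 2 + b ^+ 2 * v ^+ 2) ->
  polyakGD_step gamma (diag_quad w) 0 (row2 u v) = row2 (- rho * u) (rho * v).
Proof.
move=> v0 uv; rewrite /polyakGD_step gradient_diag_quad.
have v2 : 0 < b ^+ 2 * v ^+ 2.
  by rewrite mulr_gt0// exprn_even_gt0//= gt_eqF.
have g2 : 0 < a ^+ 2 * u ^+ 2 + b ^+ 2 * v ^+ 2.
  by rewrite ltr_wpDl// mulr_ge0// sqr_ge0.
rewrite ifF; last first.
  apply/negbTE/eqP => /rowP/(_ (lift ord0 ord0)); rewrite !mxE/= /w/=.
  by apply/eqP; rewrite mulf_neq0// gt_eqF.
have ab0 : a + b != 0 by rewrite gt_eqF// addr_gt0// (lt_trans b_gt0).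
have -> : gamma * polyak_stepsize (diag_quad w) 0 (row2 u v) = 2 / (a + b).
  rewrite /polyak_stepsize gradient_diag_quad enorm_sqr !big_ord_recl big_ord0.
  rewrite diag_quad_row2 !mxE/= /w/= addr0 subr0 !exprMn.
  apply/eqP; rewrite mulrA eqr_div ?(lt0r_neq0 g2)//; apply/eqP.
  by rewrite mulrA mulrAC uv; field.
by apply/rowP => i; rewrite !mxE /w /rho; case: ifP => _; field.
Qed.

(** The equation is homogeneous in [(u, v)] and even in [u], so it survives every step; [b < a]
    gives [rho != 0], so the second coordinate never vanishes. *)
Lemma polyakGD_row2 (u v : R) (k : nat) : v != 0 ->
  gamma * (a * u ^+ 2 + b * v ^+ 2) * (a + b)
    = 4 * (a ^+ 2 * u ^+ 2 + b ^+ 2 * v ^+ 2) ->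
  polyakGD gamma (diag_quad w) 0 (row2 u v) k
    = row2 ((- rho) ^+ k * u) (rho ^+ k * v).
Proof.
move=> v0 uv; elim: k => [|k IHk]; first by rewrite !expr0 !mul1r.
rewrite /polyakGD iterS -/(polyakGD _ _ _ _ _) IHk polyakGD_step_row2.
- by rewrite !mulrA -!exprS.
- have rho_neq0 : rho != 0.
    rewrite mulf_neq0 ?invr_eq0 ?subr_eq0 ?gt_eqF//.
    by rewrite addr_gt0// (lt_trans b_gt0).
  by rewrite mulf_neq0// expf_neq0.
- move: rho => r; rewrite !exprMn (exprAC (- r)) sqrrN exprAC.
  move: (r ^+ k ^+ 2) => c.
  transitivity (c * (gamma * (a * u ^+ 2 + b * v ^+ 2) * (a + b))); first by ring.
  by rewrite uv; ring.
Qed.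

Lemma diag_quad_polyakGD_row2 (u v : R) (k : nat) : v != 0 ->
  gamma * (a * u ^+ 2 + b * v ^+ 2) * (a + b)
    = 4 * (a ^+ 2 * u ^+ 2 + b ^+ 2 * v ^+ 2) ->
  diag_quad w (polyakGD gamma (diag_quad w) 0 (row2 u v) k)
    = rho ^+ (2 * k) * ((a * u ^+ 2 + b * v ^+ 2) / 2).
Proof.
move=> v0 uv; rewrite polyakGD_row2// diag_quad_row2; move: rho => r.
by rewrite !exprMn (exprAC (- r)) sqrrN (exprAC r k) exprM; ring.
Qed.

End PlanarCycle.

(** Invert [1 / (1 - s) = 1 + s / (1 - s) <= expR (s / (1 - s))] and take [m]-th powers. *)
Lemma expRN_le_onem_expr (R : realType) (s : R) (m : nat) : 0 <= s < 1 ->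
  expR (- (m%:R * (s / (1 - s)))) <= (1 - s) ^+ m.
Proof.
move=> /andP[s0 s1]; have s1' : 0 < 1 - s by lra.
rewrite expRN expRM_natl -exprVn.
apply: lerXn2r; rewrite ?nnegrE ?invr_ge0 ?expR_ge0 ?(ltW s1')//.
rewrite -[leRHS]invrK lef_pV2 ?posrE ?invr_gt0 ?expR_gt0//.
apply: le_trans (expR_ge1Dx _); rewrite le_eqVlt; apply/orP; left.
by apply/eqP; field; rewrite gt_eqF.
Qed.

Theorem theorem3p2 (R : realType) (gamma : R) (hgamma : 0 < gamma < 4)
    (K : nat) (hK : (1 <= K)%N) (L : R) (hL : 0 < L) :
  exists (q : 'rV[R]_2 -> R) (xstar : 'rV[R]_2) (qstar : R) (x0 : 'rV[R]_2),
    [/\ smooth L q,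
        convex_function [set: convex_lmodType 'rV[R]_2] q,
        minimizer q xstar /\ qstar = q xstar,
        x0 <> xstar
      & gamma / (2 * expR (2 * gamma) * ((4 - gamma) * K%:R + gamma))
        <= min_upto K (fun k =>
             (q (polyakGD gamma q qstar x0 k) - qstar)
               / (L * enorm (x0 - xstar) ^+ 2))].
Proof.
have /andP[g0 g4] := hgamma.
have K1 : 1 <= K%:R :> R by rewrite ler1n.
pose M : R := (4 - gamma) * K%:R + gamma.
(* Indeed [M - 4 = (4 - gamma) * (K - 1)]. *)
have M4 : 4 <= M by rewrite /M; nra.
have M0 : M != 0 by rewrite gt_eqF//; lra.
(* This [t] makes [2 * t / (4 - gamma)] equal to [gamma / (2 * M)]. *)
pose t := gamma * (4 - gamma) / (4 * M).
have tM : 4 * t * M = gamma * (4 - gamma) by rewrite /t; field.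
have t0 : 0 < t by rewrite /t divr_gt0// ?mulr_gt0//; lra.
(* The next two bounds make the radicands of [u] and [v] positive; added up, they give [t < 1 / 2],
   hence [b < L]. *)
have tg : 4 * t < gamma by nra.
have tg' : 4 * t < 4 - gamma by nra.
have t1 : 0 < 1 - t by lra.
have t1_neq0 : 1 - t != 0 by rewrite gt_eqF.
pose b := L * (t / (1 - t)).
have b0 : 0 < b by rewrite mulr_gt0// divr_gt0.
have bL : b < L by rewrite /b gtr_pMr// ltr_pdivrMr// mul1r; lra.
pose w (i : 'I_2) : R := if i == ord0 then L else b.
have w0 i : 0 <= w i by rewrite /w; case: ifP => _; rewrite ltW.
(* [u] and [v] solve [cyc] below, up to a common factor. *)
pose u := Num.sqrt (t * (gamma - 4 * t)).
pose v := Num.sqrt ((1 - t) * (4 - gamma - 4 * t)).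
have u2 : u ^+ 2 = t * (gamma - 4 * t) by rewrite sqr_sqrtr// mulr_ge0//; lra.
have v2 : v ^+ 2 = (1 - t) * (4 - gamma - 4 * t).
  by rewrite sqr_sqrtr// mulr_ge0//; lra.
have v_neq0 : v != 0 by rewrite gt_eqF// sqrtr_gt0 mulr_gt0//; lra.
have cyc : gamma * (L * u ^+ 2 + b * v ^+ 2) * (L + b)
    = 4 * (L ^+ 2 * u ^+ 2 + b ^+ 2 * v ^+ 2) by rewrite u2 v2 /b; field.
have rhoE : (L - b) / (L + b) = 1 - 2 * t.
  by rewrite /b; field; rewrite t1_neq0 gt_eqF//=; nra.
exists (diag_quad w), 0, 0, (row2 u v); split.
- apply: smooth_diag_quad => i; rewrite w0/= /w; case: ifP => // _.
  exact: ltW.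
- exact: convex_diag_quad.
- by rewrite diag_quad0; split=> //; exact: minimizer_diag_quad.
- move=> /rowP/(_ (lift ord0 ord0)); rewrite !mxE/=.
  exact/eqP.
have gap k : (k <= K)%N -> gamma / (2 * expR (2 * gamma) * M)
    <= (diag_quad w (polyakGD gamma (diag_quad w) 0 (row2 u v) k) - 0)
       / (L * enorm (row2 u v - 0) ^+ 2).
  move=> kK; rewrite diag_quad_polyakGD_row2// rhoE !subr0 enorm_sqr.
  rewrite !big_ord_recl big_ord0 !mxE/= addr0 u2 v2.
  set E := expR _; have E0 : E != 0 by rewrite gt_eqF// expR_gt0.
  have -> : gamma / (2 * E * M) = E^-1 * (2 * t / (4 - gamma)).
    by rewrite /t; field; rewrite E0 M0/= gt_eqF//; lra.
  (* Here [L * u ^+ 2 + b * v ^+ 2 = 4 * L * t * (1 - 2 * t)] and [u ^+ 2 + v ^+ 2 = (4 - gamma) *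
     (1 - 2 * t)], so [1 - 2 * t] cancels in the initial gap. *)
  rewrite [leRHS](_ : _ = (1 - 2 * t) ^+ (2 * k) * (2 * t / (4 - gamma))).
    rewrite ler_wpM2r ?divr_ge0//; [lra|lra|].
    rewrite /E -expRN.
    apply: le_trans (@expRN_le_onem_expr _ (2 * t) (2 * k) _); last lra.
    rewrite ler_expR lerN2 natrM.
    have kK' : k%:R <= K%:R :> R by rewrite ler_nat.
    have k0 : 0 <= k%:R :> R by [].
    rewrite mulrA ler_pdivrMr; last lra.
    have : 2 * K%:R * (2 * t) <= 2 * gamma * (1 - 2 * t).
      (* The factor [2 * M] lets [tM] eliminate [t]. *)
      suff : 2 * (K%:R + gamma) * t * (2 * M) <= gamma * (2 * M).
        by rewrite ler_pM2r => [h|]; lra.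
      have -> : 2 * (K%:R + gamma) * t * (2 * M)
         = (K%:R + gamma) * (4 * t * M) by ring.
      rewrite tM mulrCA ler_pM2l// /M.
      (* The difference of the two sides is [(4 - gamma) * (K - 1) + ((2 * gamma - 3) ^+ 2 + 7) /
         4]. *)
      have : 0 <= (4 - gamma) * (K%:R - 1) by rewrite mulr_ge0//; lra.
      have := sqr_ge0 (2 * gamma - 3); rewrite expr2.
      lra.
    by apply: le_trans; nra.
  rewrite /b; field.
  rewrite t1_neq0 !gt_eqF//=; nra.
(* The default value at index 1 needs the bound too; it is covered because [1 <= K]. *)
rewrite /min_upto big_nat; apply: le_bigmin => [|k /andP[_]]; last exact: gap.
exact: gap.
Qed.
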